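(* Let $\Lambda$ be a locally convex, row-finite $k$-graph, let $R$ be a commutative ring with $1$, and let $(P,S)$ be a Kumjian-Pask $\Lambda$-family in an $R$-algebra $A$. Then the subalgebra of $A$ generated by $(P,S)$ is $\operatorname{span}_R\{S_\alpha S_{\beta^*}:\alpha,\beta\in\Lambda,\ s(\alpha)=s(\beta)\}$.
   Context: $\mathbb N=\{0,1,2,\dots\}$, $k\geq 1$ is an integer, $e_1,\dots,e_k$ is the standard basis of $\mathbb N^k$, and $\leq$ on $\mathbb N^k$ is coordinatewise. A $k$-graph is a countable category $\Lambda$ with a functor $d:\Lambda\to\mathbb N^k$ (degree) satisfying the factorisation property: if $d(\lambda)=m+n$ with $m,n\in\mathbb N^k$, there are unique $\mu,\nu\in\Lambda$ with $d(\mu)=m$, $d(\nu)=n$, $\lambda=\mu\nu$. Morphisms are called paths; the set $\Lambda^0$ of objects (vertices) is identified with the set of paths of degree $0$; $r,s:\Lambda\to\Lambda^0$ are the codomain (range) and domain (source) maps, so $\lambda\mu$ is defined iff $s(\lambda)=r(\mu)$. Write $\Lambda^n=d^{-1}(n)$, $\Lambda^{\neq0}=\Lambda\setminus\Lambda^0$, $v\Lambda=\{\lambda:r(\lambda)=v\}$, $v\Lambda^n=v\Lambda\cap\Lambda^n$. $\Lambda$ is row-finite if every $v\Lambda^n$ is finite. $\Lambda$ is locally convex if for all $v\in\Lambda^0$, $i\neq j$, $\lambda\in v\Lambda^{e_i}$, $\mu\in v\Lambda^{e_j}$, the sets $s(\lambda)\Lambda^{e_j}$ and $s(\mu)\Lambda^{e_i}$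 are nonempty. For $n\in\mathbb N^k$, $\Lambda^{\leq n}=\{\lambda\in\Lambda: d(\lambda)\leq n,\text{ and } d(\lambda)_i<n_i\text{ implies } s(\lambda)\Lambda^{e_i}=\emptyset\}$, and $v\Lambda^{\leq n}=v\Lambda\cap\Lambda^{\leq n}$. Kumjian-Pask families: for each $\lambda\in\Lambda^{\neq 0}$ let $\lambda^*$ be a formal symbol; for $v\in\Lambda^0$ put $v^*=v$. $R$-algebras are associative but need not be unital. A Kumjian-Pask $\Lambda$-family $(P,S)$ in an $R$-algebra $A$ consists of elements $P_v$ ($v\in\Lambda^0$), $S_\lambda,S_{\lambda^*}$ ($\lambda\in\Lambda^{\neq0}$) of $A$ such that, with the convention $S_v=S_{v^*}=P_v$: (KP1) $P_vP_w=\delta_{v,w}P_v$; (KP2) $S_\lambda S_\mu=S_{\lambda\mu}$ and $S_{\mu^*}S_{\lambda^*}=S_{(\lambda\mu)^*}$ when $r(\mu)=s(\lambda)$, and $P_{r(\lambda)}S_\lambda=S_\lambda=S_\lambda P_{s(\lambda)}$, $P_{s(\lambda)}S_{\lambda^*}=S_{\lambda^*}=S_{\lambda^*}P_{r(\lambda)}$; (KP3$'$) $S_{\lambda^*}S_\mu=\delta_{\lambda,\mu}P_{s(\lambda)}$ for all $n\in\mathbb N^k\setminus\{0\}$ and $\lambda,\mu\in\Lambda^{\leq n}$; (KP4$'$) $P_v=\sum_{\lambda\in v\Lambda^{\leq n}}S_\lambda S_{\lambda^*}$ for all $v\in\Lambda^0$, $n\in\mathbb N^k\setminus\{0\}$.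 *)

(* Defs.v *)
From HB Require Import structures.
From mathcomp Require Import all_boot all_order all_algebra.
From mathcomp Require Import mathcomp_extra boolp classical_sets functions.
From mathcomp Require Import cardinality fsbigop.

Set Implicit Arguments.
Unset Strict Implicit.
Unset Printing Implicit Defensive.

Import GRing.Theory.
Local Open Scope classical_set_scope.
Local Open Scope ring_scope.

(* Associative R-algebras with no unit assumed: MathComp's own algebra
   structures all contain a multiplicative identity. *)
HB.mixin Record Lmodule_isNonUnitalAlgebra (R : pzRingType) A
    of GRing.Lmodule R A := {
  amul : A -> A -> A;
  amulA : associative amul;
  amulDl : left_distributive amul +%R;
  amulDr : right_distributive amul +%R;
  amulZl : forall (a : R) (x y : A), amul (a *: x) y = a *: amul x y;
  amulZr : forall (a : R) (x y : A), amul x (a *: y) = a *: amul x y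
}.

#[short(type="nonUnitalAlgType")]
HB.structure Definition NonUnitalAlgebra (R : pzRingType) :=
  { A of GRing.Lmodule R A & Lmodule_isNonUnitalAlgebra R A }.

Notation "x ** y" := (amul x y) (at level 40, left associativity) : ring_scope.

Section Algebra.
Variables (R : pzRingType) (A : nonUnitalAlgType R).

Definition is_subalgebra (B : set A) : Prop :=
  [/\ B 0,
      (forall x y, B x -> B y -> B (x + y)),
      (forall (a : R) x, B x -> B (a *: x)) &
      (forall x y, B x -> B y -> B (x ** y))].

Definition subalgebra_generated (G : set A) : set A := smallest is_subalgebra G.

Definition linear_span (G : set A) : set A :=
  [set x | exists (n : nat) (c : 'I_n -> R) (g : 'I_n -> A),
     (forall i, G (g i)) /\ x = \sum_(i < n) c i *: g i].

End Algebra.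

(* The monoid N^k; its addition and zero are the pointwise ones. *)
Notation degree k := {ffun 'I_k -> nat}.

Definition le_degree k (m n : degree k) : Prop := forall i, (m i <= n i)%N.

Definition basis_degree k (i : 'I_k) : degree k := [ffun j => (j == i : nat)].

(* Countable small categories. Composition is a total function, but
   [compose l m] is meaningful only when [src l = rng m]; nothing is assumed about
   its value otherwise. *)
Record countable_category := CountableCategory {
  vertex : countType;
  arrow : countType;
  rng : arrow -> vertex;
  src : arrow -> vertex;
  idp : vertex -> arrow;
  compose : arrow -> arrow -> arrow;
  rng_id : forall v, rng (idp v) = v;
  src_id : forall v, src (idp v) = v;
  rng_comp : forall l m, src l = rng m -> rng (compose l m) = rng l;
  src_comp : forall l m, src l = rng m -> src (compose l m) = src m;
  comp_idl : forall l, compose (idp (rng l)) l = l;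
  comp_idr : forall l, compose l (idp (src l)) = l;
  compA : forall l m n, src l = rng m -> src m = rng n ->
    compose l (compose m n) = compose (compose l m) n
}.

Record kgraph (k : nat) := KGraph {
  kgraph_category :> countable_category;
  deg : arrow kgraph_category -> degree k;
  deg_id : forall v, deg (idp v) = 0;
  deg_comp : forall l m, src l = rng m -> deg (compose l m) = deg l + deg m;
  factorisation : forall l (m n : degree k), deg l = m + n ->
    exists! p : arrow kgraph_category * arrow kgraph_category,
      [/\ deg p.1 = m, deg p.2 = n, src p.1 = rng p.2 & l = compose p.1 p.2]
}.

Section KGraph.
Variables (k : nat) (L : kgraph k).

Definition paths_from (v : vertex L) (n : degree k) : set (arrow L) :=
  [set l | rng l = v /\ deg l = n].

Definition row_finite : Prop := forall v n, finite_set (paths_from v n).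

Definition locally_convex : Prop :=
  forall (v : vertex L) (i j : 'I_k) (l m : arrow L), i != j ->
    paths_from v (basis_degree i) l -> paths_from v (basis_degree j) m ->
    paths_from (src l) (basis_degree j) !=set0 /\
    paths_from (src m) (basis_degree i) !=set0.

Definition le_paths (n : degree k) : set (arrow L) :=
  [set l | le_degree (deg l) n /\
     forall i, (deg l i < n i)%N -> paths_from (src l) (basis_degree i) = set0].

Definition le_paths_from (v : vertex L) (n : degree k) : set (arrow L) :=
  [set l | rng l = v] `&` le_paths n.

End KGraph.

Section KumjianPask.
Variables (k : nat) (L : kgraph k) (R : pzRingType) (A : nonUnitalAlgType R).
Variables (P : vertex L -> A) (S Sst : arrow L -> A).

(* [Sst l] is S_{l^*}. A family consists of the P_v and of the S_l, S_{l^*} for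
   paths l of nonzero degree; [S] and [Sst] are total on paths, and [kp_S_id],
   [kp_Sst_id] express the convention S_v = S_{v^*} = P_v, which fixes them on
   the paths of degree 0, since these are exactly the [idp v].
   The sum in [kp4] is over a finite set when [L] is row-finite. *)
Record kumjian_pask_family : Prop := KumjianPaskFamily {
  kp_S_id : forall v, S (idp v) = P v;
  kp_Sst_id : forall v, Sst (idp v) = P v;
  kp1 : forall v w, P v ** P w = if v == w then P v else 0;
  kp2_S : forall l m, src l = rng m -> S l ** S m = S (compose l m);
  kp2_Sst : forall l m, src l = rng m -> Sst m ** Sst l = Sst (compose l m);
  kp2_PS : forall l, P (rng l) ** S l = S l;
  kp2_SP : forall l, S l ** P (src l) = S l;
  kp2_PSst : forall l, P (src l) ** Sst l = Sst l;
  kp2_SstP : forall l, Sst l ** P (rng l) = Sst l;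
  kp3 : forall n : degree k, n != 0 -> forall l m,
    le_paths n l -> le_paths n m ->
    Sst l ** S m = if l == m then P (src l) else 0;
  kp4 : forall (v : vertex L) (n : degree k), n != 0 ->
    P v = \sum_(l \in le_paths_from v n) (S l ** Sst l)
}.

Definition family_elements : set A :=
  [set a | (exists v, a = P v) \/
           (exists2 l, deg l != 0 & a = S l \/ a = Sst l)].

Definition spanning_elements : set A :=
  [set a | exists al be : arrow L, src al = src be /\ a = S al ** Sst be].

End KumjianPask.

(* Main.v *)
Require Import Defs.
From mathcomp Require Import all_boot all_algebra.
From mathcomp Require Import classical_sets.
From mathcomp Require Import fsbigop.

(** Everything reduces to writing [S_{l^*} S_m] as a finite sum of terms
    [S_a S_{b^*}] with [r(a) = s(l)], [r(b) = s(m)] and [s(a) = s(b)].  Choose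
    [q] above both degrees and expand [P_{s(l)}] and [P_{s(m)}] by (KP4') in
    degrees [q - d(l)] and [q - d(m)]: the products [l a] and [m b] then all lie
    in [Lambda^{<= q}], and (KP3') evaluates [S_{(l a)^*} S_{m b}].  The choice
    [q = d(l) + d(m) + (1, ..., 1)] keeps all the degrees involved nonzero, as
    (KP3') and (KP4') require. *)

Import GRing.Theory.
Local Open Scope classical_set_scope.
Local Open Scope ring_scope.

Section NonUnitalAlgebra.
Variables (R : pzRingType) (A : nonUnitalAlgType R).
Implicit Types (x y : A) (G B : set A).

Lemma amul0l x : 0 ** x = 0.
Proof. by rewrite -(scale0r 0) amulZl !scale0r. Qed.

Lemma amul0r x : x ** 0 = 0.
Proof. by rewrite -(scale0r 0) amulZr !scale0r. Qed.

Lemma amul_suml (I : Type) (r : seq I) (F : I -> A) x :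
  (\sum_(i <- r) F i) ** x = \sum_(i <- r) F i ** x.
Proof. exact: (big_morph (fun y => y ** x) (fun y z => amulDl y z x) (amul0l x)). Qed.

Lemma amul_sumr (I : Type) (r : seq I) (F : I -> A) x :
  x ** (\sum_(i <- r) F i) = \sum_(i <- r) x ** F i.
Proof. exact: (big_morph (fun y => x ** y) (amulDr x) (amul0r x)). Qed.

Lemma linear_span0 G : linear_span G 0.
Proof.
exists 0%N, (fun=> 0), (fun=> 0); split; first by case.
by rewrite big_ord0.
Qed.

Lemma linear_spanD G x y :
  linear_span G x -> linear_span G y -> linear_span G (x + y).
Proof.
move=> [m [c [g [Gg ->]]]] [n [d [h [Gh ->]]]].
exists (m + n)%N,
  (fun i => match split i with inl j => c j | inr j => d j end),
  (fun i => match split i with inl j => g j | inr j => h j end).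
split; first by move=> i; case: (split i).
rewrite big_split_ord /=; congr (_ + _); apply: eq_bigr => i _.
  by rewrite -[lshift n i]/(unsplit (inl i)) unsplitK.
by rewrite -[rshift m i]/(unsplit (inr i)) unsplitK.
Qed.

Lemma linear_spanZ G (a : R) x : linear_span G x -> linear_span G (a *: x).
Proof.
move=> [n [c [g [Gg ->]]]]; exists n, (fun i => a * c i), g; split=> //.
by rewrite scaler_sumr; apply: eq_bigr => i _; rewrite scalerA.
Qed.

Lemma sub_linear_span G : G `<=` linear_span G.
Proof.
move=> x Gx; exists 1%N, (fun=> 1), (fun=> x); split=> //.
by rewrite big_ord1 scale1r.
Qed.

(** Serves as the induction principle for spans: [B] will be the predicate to prove. *)
Lemma linear_span_sub G B : B 0 -> (forall x y, B x -> B y -> B (x + y)) ->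
  (forall (a : R) x, B x -> B (a *: x)) -> G `<=` B -> linear_span G `<=` B.
Proof.
move=> B0 BD BZ GB _ [n [c [g [Gg ->]]]].
by apply: (big_ind B) => // i _; apply/BZ/GB.
Qed.

Lemma linear_span_subalgebra G :
  (forall x y, G x -> G y -> linear_span G (x ** y)) ->
  is_subalgebra (linear_span G).
Proof.
move=> GM; split; [exact: linear_span0 | exact: linear_spanD
  | exact: linear_spanZ | move=> x y Gx Gy].
(* Bilinearity: induct on the left factor with [y] fixed in the span, then on the right factor with
   a generator on the left. *)
apply: (linear_span_sub G (fun x => linear_span G (x ** y))) Gx.
- by rewrite amul0l; apply: linear_span0.
- by move=> x1 x2 ? ?; rewrite amulDl; apply: linear_spanD.
- by move=> a x1 ?; rewrite amulZl; apply: linear_spanZ.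
move=> {}x Gx; apply: (linear_span_sub G (fun y => linear_span G (x ** y))) Gy.
- by rewrite amul0r; apply: linear_span0.
- by move=> y1 y2 ? ?; rewrite amulDr; apply: linear_spanD.
- by move=> a y1 ?; rewrite amulZr; apply: linear_spanZ.
by move=> {}y; apply: GM.
Qed.

End NonUnitalAlgebra.

Section Paths.
Variables (k : nat) (L : kgraph k).
Implicit Types (l m : arrow L) (n : degree k).

(** Both [(idp (rng l), l)] and [(l, idp (src l))] factor [l] along [0 = 0 + 0], so uniqueness
    identifies them. *)
Lemma deg0_idp l : deg l = 0 -> l = idp (rng l).
Proof.
move=> l0; have l00 : deg l = 0 + 0 by rewrite l0 addr0.
have [p [_ p_unique]] := factorisation l00.
have eq1 : p = (idp (rng l), l).
  by apply: p_unique; split; rewrite ?deg_id ?src_id ?comp_idl.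
have eq2 : p = (l, idp (src l)).
  by apply: p_unique; split; rewrite ?deg_id ?rng_id ?comp_idr.
by move: eq1; rewrite eq2 => -[].
Qed.

(** Prefixing by [l] shifts the degree and the bound by [deg l] and keeps the source, so maximality
    of [m] carries over. *)
Lemma le_paths_compose n l m :
  src l = rng m -> le_paths n m -> le_paths (deg l + n) (compose l m).
Proof.
move=> lm [mn m_max]; rewrite /le_paths /= deg_comp // src_comp //.
by split=> i; rewrite !ffunE ?leq_add2l // ltn_add2l; apply: m_max.
Qed.

End Paths.

Section KumjianPask.
Variables (k : nat) (L : kgraph k) (R : pzRingType) (A : nonUnitalAlgType R).
Variables (P : vertex L -> A) (S Sst : arrow L -> A).
Hypothesis hKP : kumjian_pask_family P S Sst.
Local Notation span := (linear_span (spanning_elements S Sst)).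

Lemma kp4_seq v (n : degree k) : n != 0 ->
  exists2 s : seq (arrow L), {in s, forall l, le_paths_from v n l} &
    P v = \sum_(l <- s) S l ** Sst l.
Proof.
move=> n0; rewrite (kp4 hKP v n0); eexists; last by reflexivity.
(* The list is the one over which the finitely supported sum is defined: either empty by default, or
   the support [X], which lies in the index set. *)
by case: finite_supportP => // X XP _ _ l lX; apply: XP.
Qed.

Lemma Sst_mul_S_sum (l m : arrow L) : (0 < k)%N ->
  exists s t : seq (arrow L),
    [/\ {in s, forall a, src l = rng a}, {in t, forall b, src m = rng b} &
      Sst l ** S m = \sum_(a <- s) \sum_(b <- t)
        if compose l a == compose m b then S a ** Sst b else 0].
Proof.
move=> k_gt0; pose u : degree k := [ffun=> 1%N].
have nz (n : degree k) : n + u != 0.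
  apply/eqP => /ffunP/(_ (Ordinal k_gt0)).
  by rewrite !ffunE -[_ + _]/(_ + _)%N addn1.
(* With [q = deg l + deg m + u], the differences [q - deg l] and [q - deg m] are [deg m + u] and
   [deg l + u]. *)
have [s sP Pl] := kp4_seq (src l) _ (nz (deg m)).
have [t tP Pm] := kp4_seq (src m) _ (nz (deg l)).
have la a : a \in s -> src l = rng a by case/sP.
have mb b : b \in t -> src m = rng b by case/tP.
exists s, t; split=> //.
rewrite -(kp2_PSst hKP l) -(kp2_SP hKP m) Pl Pm !amul_suml.
apply: eq_big_seq => a a_s.
rewrite !amul_sumr; apply: eq_big_seq => b b_t.
have la_max : le_paths (deg l + deg m + u) (compose l a).
  by rewrite -addrA; apply: le_paths_compose _ _ _ (la a a_s) (sP a a_s).2.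
have mb_max : le_paths (deg l + deg m + u) (compose m b).
  rewrite (addrC (deg l)) -addrA.
  exact: le_paths_compose _ _ _ (mb b b_t) (tP b b_t).2.
(* The inner factors merge by (KP2), the starred ones in reverse order; (KP3') then leaves
   [P (src a)] or 0, and [S a] absorbs [P (src a)]. *)
transitivity (S a ** (Sst (compose l a) ** S (compose m b)) ** Sst b).
  by rewrite -(kp2_Sst hKP (la a a_s)) -(kp2_S hKP (mb b b_t)) !amulA.
rewrite (kp3 hKP (nz _) la_max mb_max) (src_comp (la a a_s)).
by case: ifP => _; rewrite ?(kp2_SP hKP) ?amul0r ?amul0l.
Qed.

Lemma spanning_mul_span (a b c d : arrow L) : (0 < k)%N ->
  src a = src b -> src c = src d ->
  span ((S a ** Sst b) ** (S c ** Sst d)).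
Proof.
move=> k_gt0 ab cd; have [s [t [sP tP bcE]]] := Sst_mul_S_sum b c k_gt0.
(* [big_seq] retains the list membership from which composability of [a] with [e], and below of [d]
   with [f], is derived. *)
rewrite amulA -(amulA (S a)) bcE amul_sumr amul_suml big_seq.
apply: (big_ind span) => [||e e_s];
  [exact: linear_span0 | exact: linear_spanD |].
rewrite amul_sumr amul_suml big_seq.
apply: (big_ind span) => [||f f_t];
  [exact: linear_span0 | exact: linear_spanD |].
have ae : src a = rng e by rewrite ab (sP e e_s).
have df : src d = rng f by rewrite -cd (tP f f_t).
case: eqP => [becf|_]; last by rewrite amul0r amul0l; apply: linear_span0.
(* The surviving terms have [compose b e = compose c f], which forces [src e = src f]. *)
apply: sub_linear_span; exists (compose a e), (compose d f); split.
  by rewrite !src_comp // -(src_comp (sP e e_s)) becf src_comp //; apply: tP.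
by rewrite amulA (kp2_S hKP ae) -amulA (kp2_Sst hKP df).
Qed.

End KumjianPask.

Theorem corollary3p4 (k : nat) (hk : (0 < k)%N) (L : kgraph k)
  (hconv : locally_convex L) (hfin : row_finite L)
  (R : comPzRingType) (A : nonUnitalAlgType R)
  (P : vertex L -> A) (S Sst : arrow L -> A)
  (hKP : kumjian_pask_family P S Sst) :
  subalgebra_generated (family_elements P S Sst) =
  linear_span (spanning_elements S Sst).
Proof.
apply/seteqP; split.
  apply: smallest_sub.
    apply: linear_span_subalgebra => _ _ [a [b [ab ->]]] [c [d [cd ->]]].
    exact: (spanning_mul_span _ _ _ _ _ _ _ hKP).
  move=> x xfam; apply: sub_linear_span.
  case: xfam => [[v ->]|[l _ [->|->]]].
  - exists (idp v), (idp v).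
    by rewrite (kp_S_id hKP) (kp_Sst_id hKP) (kp1 hKP) eqxx.
  - by exists l, (idp (src l)); rewrite src_id (kp_Sst_id hKP) (kp2_SP hKP).
  by exists (idp (src l)), l; rewrite src_id (kp_S_id hKP) (kp2_PSst hKP).
move=> x xspan B [[B0 BD BZ BM] famB].
have BP v : B (P v) by apply: famB; left; exists v.
(* The family lists [S l] and [Sst l] only in nonzero degree; a path of degree 0 is an identity,
   where both equal some [P v]. *)
have BS l : B (S l) /\ B (Sst l).
  have [/deg0_idp ->|l_n0] := eqVneq (deg l) 0.
    by rewrite (kp_S_id hKP) (kp_Sst_id hKP).
  by split; apply: famB; right; exists l => //; [left|right].
apply: linear_span_sub xspan => // _ [a [b [_ ->]]].
by apply: BM; [case: (BS a) | case: (BS b)].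
Qed.
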